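(* Let $M/N$ be a strongly separable extension of index $\lambda^{-1}$ with Jones tower $N\subseteq M=M_0\subseteq M_1\subseteq M_2\subseteq\cdots$, and let $n\ge 0$. Let $$F_n=E\circ E_M\circ\cdots\circ E_{M_{n-1}}:M_n\to N,\qquad F_{M_n}=E_{M_n}\circ\cdots\circ E_{M_{2n}}:M_{2n+1}\to M_n,$$ and $$f_n=\lambda^{-n(n+1)/2}(e_{n+1}e_n\cdots e_1)(e_{n+2}e_{n+1}\cdots e_2)\cdots(e_{2n+1}e_{2n}\cdots e_{n+1})\in M_{2n+1}.$$ Then $f_n$ is an idempotent satisfying the characterizing properties of the basic construction: $$M_{2n+1}=M_nf_nM_n,$$ $$f_nxf_n=f_nF_n(x)=F_n(x)f_n\quad\text{for all }x\in M_n,$$ $$F_{M_n}(f_n)=\lambda^{n+1}1.$$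
   Context: $k$ is a field and algebras are unital associative $k$-algebras; summation over repeated indices is understood. An algebra extension $M/N$ is strongly separable of index $\lambda^{-1}$, where $0\ne\lambda\in k$, if there are an $N$-$N$-bimodule map $E:M\to N$ with $E(1)=1$ and finite families $\{x_i\},\{y_i\}$ in $M$ (dual bases) with $E(mx_i)y_i=m=x_iE(y_im)$ for all $m\in M$ and $x_iy_i=\lambda^{-1}1$. No Markov trace is assumed. The basic construction of $M/N$ is $M_1=M\otimes_NM$ with $e_1=1\otimes1$ (Jones idempotent), elements written $me_1m'=m\otimes m'$, product $(me_1m')(ne_1n')=mE(m'n)e_1n'$, unit $x_ie_1y_i$, inclusion $M\subset M_1$ via $m\mapsto mx_ie_1y_i$, and $E_M:M_1\to M$, $E_M(me_1m')=\lambda mm'$. $M_1/M$ is again strongly separable of index $\lambda^{-1}$ with bimodule projection $E_M$ and dual bases $\{\lambda^{-1}x_ie_1\}$, $\{e_1y_i\}$. Iterating gives the Jones tower: $M_0=M$, $M_{i+1}=M_ie_{i+1}M_i$ is the basic construction of $M_i$ over $M_{i-1}$ (with $M_{-1}=N$), with Jones idempotent $e_{i+1}\in M_{i+1}$ and bimodule projection $E_{M_i}:M_{i+1}\to M_i$ (with $E_{M_0}=E_M$). For $n=0$, $F_0=E$. Here $M_nf_nM_n$ denotes the linear span of products $xf_ny$, $x,y\in M_n$. *)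

(* Defs.v *)
From HB Require Import structures.
From mathcomp Require Import all_boot all_order all_algebra.
From mathcomp Require Import boolp.

Set Implicit Arguments.
Unset Strict Implicit.
Unset Printing Implicit Defensive.

Import GRing.Theory.
Local Open Scope ring_scope.
Local Open Scope quotient_scope.

(* An extension M/N is given by an algebra morphism iota : N -> M. For the    *)
(* strongly separable extensions below iota is automatically injective, as    *)
(* E (iota n) = n, so N is identified with a unital subalgebra of M.          *)
(* algType makes every algebra nonzero (1 != 0).                              *)

Section Tensor.
Variables (k : fieldType) (N M : algType k) (iota : {lrmorphism N -> M}).

(* M (x)_N M is the quotient of the free commutative monoid on M * M, whose   *)
(* elements are the formal sums a_1 (x) b_1 + ... + a_r (x) b_r up to order,  *)
(* by the smallest congruence containing the bilinearity and N-balancing      *)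
(* relations. The relation 0 (x) b ~ 0 makes the quotient a group.            *)
Inductive tens_rel : seq (M * M) -> seq (M * M) -> Prop :=
| tens_refl s : tens_rel s s
| tens_sym s t : tens_rel s t -> tens_rel t s
| tens_trans s t u : tens_rel s t -> tens_rel t u -> tens_rel s u
| tens_cat s s' t t' :
    tens_rel s s' -> tens_rel t t' -> tens_rel (s ++ t) (s' ++ t')
| tens_catC s t : tens_rel (s ++ t) (t ++ s)
| tens_zero b : tens_rel [:: (0, b)] [::]
| tens_addl a a' b : tens_rel [:: (a + a', b)] [:: (a, b); (a', b)]
| tens_addr a b b' : tens_rel [:: (a, b + b')] [:: (a, b); (a, b')]
| tens_mid a n b : tens_rel [:: (a * iota n, b)] [:: (a, iota n * b)].

Definition tens_eqb (s t : seq (M * M)) : bool := `[< tens_rel s t >].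

Lemma tens_eqb_equiv : equiv_class_of tens_eqb.
Proof.
split=> [s|s t|t s u].
- by apply/asboolP; apply: tens_refl.
- by apply/asboolP/asboolP => /tens_sym.
- by move=> /asboolP st /asboolP tu; apply/asboolP; apply: tens_trans tu.
Qed.

Canonical tens_equiv := EquivRelPack tens_eqb_equiv.
Canonical tens_encModRel := defaultEncModRel tens_eqb.

Definition tensor := {eq_quot tens_eqb}.

HB.instance Definition _ := EqQuotient.on tensor.
HB.instance Definition _ := Choice.on tensor.

Definition tclass (s : seq (M * M)) : tensor := \pi_tensor s.

Lemma tclassP s t : tens_rel s t -> tclass s = tclass t.
Proof. by move=> st; apply/eqP; rewrite piE; apply/asboolP. Qed.

Lemma tclass_rel s t : tclass s = tclass t -> tens_rel s t.
Proof. by move=> /eqP; rewrite piE => /asboolP. Qed.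

Lemma repr_tclass s : tens_rel (repr (tclass s)) s.
Proof. by apply: tclass_rel; rewrite /tclass reprK. Qed.

Definition tens0 : tensor := tclass [::].
Definition tens_add (u v : tensor) : tensor := tclass (repr u ++ repr v).
Definition tens_opp (u : tensor) : tensor :=
  tclass [seq (- p.1, p.2) | p <- repr u].

Lemma tens_ind_class (P : tensor -> Prop) :
  (forall s, P (tclass s)) -> forall u, P u.
Proof. by move=> Ps u; rewrite -[u]reprK; apply: Ps. Qed.

Lemma tens_add_class s t : tens_add (tclass s) (tclass t) = tclass (s ++ t).
Proof. by apply: tclassP; apply: tens_cat; apply: repr_tclass. Qed.

Lemma tens_opp_class s : tens_opp (tclass s) = tclass [seq (- p.1, p.2) | p <- s].
Proof.
apply: tclassP; have := repr_tclass s; move: (repr _) => r.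
elim=> [?|? ? _|? ? ? _ + _|? ? ? ? _ + _|? ?|?|? ? ?|? ? ?|? ? ?] /=.
- exact: tens_refl.
- exact: tens_sym.
- exact: tens_trans.
- by rewrite !map_cat; apply: tens_cat.
- by rewrite !map_cat; apply: tens_catC.
- by rewrite oppr0; apply: tens_zero.
- by rewrite opprD; apply: tens_addl.
- exact: tens_addr.
- by rewrite -mulNr; apply: tens_mid.
Qed.

Lemma tens_addA : associative tens_add.
Proof.
elim/tens_ind_class=> s; elim/tens_ind_class=> t; elim/tens_ind_class=> u.
by rewrite !tens_add_class catA.
Qed.

Lemma tens_addC : commutative tens_add.
Proof.
elim/tens_ind_class=> s; elim/tens_ind_class=> t.
by rewrite !tens_add_class; apply: tclassP; apply: tens_catC.
Qed.

Lemma tens_add0 : left_id tens0 tens_add.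
Proof. by elim/tens_ind_class=> s; rewrite tens_add_class. Qed.

Lemma tens_addN : left_inverse tens0 tens_opp tens_add.
Proof.
elim/tens_ind_class=> s; rewrite tens_opp_class tens_add_class.
apply: tclassP; elim: s => [|[a b] s IHs]; first exact: tens_refl.
rewrite map_cons /=; move: [seq _ | _ <- s] IHs => u IHs.
apply: (@tens_trans _ ([:: (- a, b); (a, b)] ++ (u ++ s))).
  apply: (@tens_cat [:: (- a, b)] [:: (- a, b)] (u ++ _) (_ :: (u ++ s))).
    exact: tens_refl.
  rewrite -cat1s catA -[_ :: (u ++ s)]/(([:: (a, b)] ++ u) ++ s).
  by apply: tens_cat; [apply: tens_catC|apply: tens_refl].
apply: (@tens_cat _ [::] _ [::]) => //.
apply: (@tens_trans _ [:: (- a + a, b)]); first exact/tens_sym/tens_addl.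
by rewrite addNr; apply: tens_zero.
Qed.

HB.instance Definition _ :=
  GRing.isZmodule.Build tensor tens_addA tens_addC tens_add0 tens_addN.

Definition tens (a b : M) : tensor := tclass [:: (a, b)].

Record balanced (A : zmodType) (beta : M -> M -> A) : Prop := Balanced {
  balDl : forall a a' b, beta (a + a') b = beta a b + beta a' b;
  balDr : forall a b b', beta a (b + b') = beta a b + beta a b';
  balM : forall a n b, beta (a * iota n) b = beta a (iota n * b) }.

(* The additive map on the tensor product determined by a balanced map.       *)
Definition tlift (A : zmodType) (beta : M -> M -> A) (u : tensor) : A :=
  \sum_(p <- repr u) beta p.1 p.2.

Section Lift.
Variables (A : zmodType) (beta : M -> M -> A).
Hypothesis betaP : balanced beta.

Lemma tlift_class s : tlift beta (tclass s) = \sum_(p <- s) beta p.1 p.2.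
Proof.
have := repr_tclass s; rewrite /tlift; move: (repr _) => r.
elim=> // {r s} [s t u _ -> _|s s' t t' _ IHs _ IHt|s t|b|a a' b|a b b'|a n b] //=.
- by rewrite !big_cat /= IHs IHt.
- by rewrite !big_cat /= addrC.
- rewrite big_seq1 big_nil /=.
  by apply: (addIr (beta 0 b)); rewrite -(balDl betaP) !add0r.
- by rewrite big_seq1 big_cons big_seq1 (balDl betaP).
- by rewrite big_seq1 big_cons big_seq1 (balDr betaP).
- by rewrite !big_seq1 (balM betaP).
Qed.

Lemma tlift_tens a b : tlift beta (tens a b) = beta a b.
Proof. by rewrite tlift_class big_seq1. Qed.

Lemma tliftD u v : tlift beta (u + v) = tlift beta u + tlift beta v.
Proof.
elim/tens_ind_class: u => s; elim/tens_ind_class: v => t.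
by rewrite [_ + _]tens_add_class !tlift_class big_cat.
Qed.

Lemma tlift0 : tlift beta 0 = 0.
Proof. by apply: (addIr (tlift beta 0)); rewrite -tliftD !add0r. Qed.

End Lift.

Lemma tens_balanced : balanced tens.
Proof.
split=> *.
- by rewrite [RHS]tens_add_class; apply: tclassP; apply: tens_addl.
- by rewrite [RHS]tens_add_class; apply: tclassP; apply: tens_addr.
- by apply: tclassP; apply: tens_mid.
Qed.

Lemma tensDl a a' b : tens (a + a') b = tens a b + tens a' b.
Proof. exact: (balDl tens_balanced). Qed.

Lemma tensDr a b b' : tens a (b + b') = tens a b + tens a b'.
Proof. exact: (balDr tens_balanced). Qed.

Lemma tensM a n b : tens (a * iota n) b = tens a (iota n * b).
Proof. exact: (balM tens_balanced). Qed.

Lemma tens0l b : tens 0 b = 0.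
Proof. by apply: (addIr (tens 0 b)); rewrite -tensDl !add0r. Qed.

Lemma tens0r a : tens a 0 = 0.
Proof. by apply: (addIr (tens a 0)); rewrite -tensDr !add0r. Qed.

Lemma tens_suml I (r : seq I) (F : I -> M) b :
  tens (\sum_(i <- r) F i) b = \sum_(i <- r) tens (F i) b.
Proof.
by apply: (big_morph (tens^~ b)) => [a a'|]; rewrite (tensDl, tens0l).
Qed.

Lemma tens_sumr I (r : seq I) (F : I -> M) a :
  tens a (\sum_(i <- r) F i) = \sum_(i <- r) tens a (F i).
Proof. by apply: (big_morph (tens a)) => [b b'|]; rewrite (tensDr, tens0r). Qed.

Lemma tens_scale c a b : tens (c *: a) b = tens a (c *: b).
Proof.
have e x : c *: x = iota c%:A * x by rewrite rmorph_alg mulr_algl.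
have e' x : c *: x = x * iota c%:A by rewrite rmorph_alg mulr_algr.
by rewrite (e b) (e' a) tensM.
Qed.

Lemma tens_ind (P : tensor -> Prop) :
  (forall a b, P (tens a b)) -> P 0 -> (forall u v, P u -> P v -> P (u + v)) ->
  forall u, P u.
Proof.
move=> Pt P0 PD; elim/tens_ind_class; elim=> [//|[a b] s Ps].
by rewrite -cat1s -tens_add_class; apply: (PD (tens a b) (tclass s)).
Qed.

Definition tens_scaling (c : k) (u : tensor) : tensor :=
  tlift (fun a b => tens (c *: a) b) u.

Lemma tens_scaling_balanced c : balanced (fun a b => tens (c *: a) b).
Proof.
split=> *; first by rewrite scalerDr tensDl.
  by rewrite tensDr.
by rewrite scalerAl tensM.
Qed.

Lemma tens_scalingE c a b : tens_scaling c (tens a b) = tens (c *: a) b.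
Proof. exact: (tlift_tens (tens_scaling_balanced c)). Qed.

Lemma tens_scalingD c u v :
  tens_scaling c (u + v) = tens_scaling c u + tens_scaling c v.
Proof. exact: (tliftD (tens_scaling_balanced c)). Qed.

Lemma tens_scaling0 c : tens_scaling c 0 = 0.
Proof. exact: (tlift0 (tens_scaling_balanced c)). Qed.

Lemma tens_scalingA c d u :
  tens_scaling c (tens_scaling d u) = tens_scaling (c * d) u.
Proof.
elim/tens_ind: u => [a b||u v IHu IHv].
- by rewrite !tens_scalingE scalerA.
- by rewrite !tens_scaling0.
- by rewrite !tens_scalingD IHu IHv.
Qed.

Lemma tens_scaling1 : left_id 1 tens_scaling.
Proof.
elim/tens_ind=> [a b||u v IHu IHv].
- by rewrite !tens_scalingE scale1r.
- by rewrite !tens_scaling0.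
- by rewrite !tens_scalingD IHu IHv.
Qed.

Lemma tens_scalingDl u : {morph tens_scaling^~ u : c d / c + d}.
Proof.
move=> c d /=; elim/tens_ind: u => [a b||u v IHu IHv].
- by rewrite !tens_scalingE scalerDl tensDl.
- by rewrite !tens_scaling0 addr0.
- by rewrite !tens_scalingD IHu IHv addrACA.
Qed.

HB.instance Definition _ :=
  GRing.Zmodule_isLmodule.Build k tensor
    tens_scalingA tens_scaling1 tens_scalingD tens_scalingDl.

Lemma tensZ c a b : c *: tens a b = tens (c *: a) b.
Proof. exact: tens_scalingE. Qed.

End Tensor.

Arguments tens {k N M} iota a b.
Arguments tlift {k N M} iota {A} beta u.

Record strongly_separable (k : fieldType) (lam : k) (N M : algType k)
    (iota : {lrmorphism N -> M}) (E : {additive M -> N})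
    (r : nat) (x y : 'I_r -> M) : Prop := StronglySeparable {
  ss_index : lam != 0;
  ss_bimodl : forall n m, E (iota n * m) = n * E m;
  ss_bimodr : forall m n, E (m * iota n) = E m * n;
  ss_unital : E 1 = 1;
  ss_dualr : forall m, \sum_(i < r) iota (E (m * x i)) * y i = m;
  ss_duall : forall m, \sum_(i < r) x i * iota (E (y i * m)) = m;
  ss_sum : \sum_(i < r) x i * y i = lam^-1%:A }.

Record extension (k : fieldType) (lam : k) := Extension {
  ext_bot : algType k;
  ext_top : algType k;
  incl : {lrmorphism ext_bot -> ext_top};
  proj : {additive ext_top -> ext_bot};
  rk : nat;
  dbx : 'I_rk -> ext_top;
  dby : 'I_rk -> ext_top;
  extensionP : strongly_separable lam incl proj dbx dby }.

Arguments dbx {k lam e} i.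
Arguments dby {k lam e} i.

Section BasicConstruction.
Variables (k : fieldType) (lam : k) (S : extension lam).
Local Notation N := (ext_bot S).
Local Notation M := (ext_top S).
Local Notation iota := (incl S).
Local Notation E := (proj S).
Local Notation r := (rk S).
Local Notation x := (@dbx _ _ S).
Local Notation y := (@dby _ _ S).
Local Notation SP := (extensionP S).

Definition basic := tensor (incl S).

HB.instance Definition _ := GRing.Lmodule.on basic.

Local Notation "a ⊗ b" := (tens iota a b : basic) (at level 38).

(* (a (x) b) (c (x) d) = a E(b c) (x) d                                       *)
Definition basic_mul (u v : basic) : basic :=
  tlift iota (fun a b => tlift iota (fun c d => (a * iota (E (b * c))) ⊗ d) v) u.

Definition basic_one : basic := \sum_(i < r) x i ⊗ y i.

Lemma basic_mul_bal2 a b :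
  balanced iota (fun c d => (a * iota (E (b * c))) ⊗ d).
Proof.
split=> [c c' d|c d d'|c n d].
- by rewrite mulrDr raddfD raddfD mulrDr tensDl.
- by rewrite tensDr.
- by rewrite -tensM mulrA (ss_bimodr SP) rmorphM mulrA.
Qed.

Lemma basic_mul_bal1 v :
  balanced iota (fun a b => tlift iota (fun c d => (a * iota (E (b * c))) ⊗ d) v).
Proof.
have t0 a b := tlift0 (basic_mul_bal2 a b).
have tD a b := tliftD (basic_mul_bal2 a b).
have tE a b := tlift_tens (basic_mul_bal2 a b).
split=> [a a' b|a b b'|a n b]; elim/tens_ind: v => [c d||u v IHu IHv].
- by rewrite !tE mulrDl tensDl.
- by rewrite !t0 addr0.
- by rewrite !tD IHu IHv addrACA.
- by rewrite !tE mulrDl raddfD raddfD mulrDr tensDl.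
- by rewrite !t0 addr0.
- by rewrite !tD IHu IHv addrACA.
- by rewrite !tE -mulrA -rmorphM -mulrA (ss_bimodl SP).
- by rewrite !t0.
- by rewrite !tD IHu IHv.
Qed.

Lemma basic_mulE a b c d :
  basic_mul (a ⊗ b) (c ⊗ d) = (a * iota (E (b * c))) ⊗ d.
Proof.
by rewrite /basic_mul (tlift_tens (basic_mul_bal1 _))
   (tlift_tens (basic_mul_bal2 _ _)).
Qed.

Lemma basic_mulDl : left_distributive basic_mul +%R.
Proof. by move=> u v w; apply: (tliftD (basic_mul_bal1 w)). Qed.

Lemma basic_mul0l u : basic_mul 0 u = 0.
Proof. exact: (tlift0 (basic_mul_bal1 u)). Qed.

Lemma basic_mulDr : right_distributive basic_mul +%R.
Proof.
elim/tens_ind=> [a b||u v IHu IHv] w w'.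
- by rewrite /basic_mul !(tlift_tens (basic_mul_bal1 _))
     (tliftD (basic_mul_bal2 a b)).
- by rewrite !basic_mul0l addr0.
- by rewrite !basic_mulDl IHu IHv addrACA.
Qed.

Lemma basic_mul0r u : basic_mul u 0 = 0.
Proof. by apply: (addIr (basic_mul u 0)); rewrite -basic_mulDr !add0r. Qed.

Lemma basic_mul_suml I (s : seq I) (F : I -> basic) v :
  basic_mul (\sum_(i <- s) F i) v = \sum_(i <- s) basic_mul (F i) v.
Proof.
by apply: (big_morph (basic_mul^~ v)) => [u u'|];
   rewrite (basic_mulDl, basic_mul0l).
Qed.

Lemma basic_mul_sumr I (s : seq I) (F : I -> basic) u :
  basic_mul u (\sum_(i <- s) F i) = \sum_(i <- s) basic_mul u (F i).
Proof.
by apply: (big_morph (basic_mul u)) => [v v'|];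
   rewrite (basic_mulDr, basic_mul0r).
Qed.

Lemma basic_mulA : associative basic_mul.
Proof.
elim/tens_ind=> [a b||u u' IHu IHu'] v w; last 2 first.
- by rewrite !basic_mul0l.
- by rewrite !basic_mulDl IHu IHu'.
elim/tens_ind: v => [c d||v v' IHv IHv']; last 2 first.
- by rewrite basic_mul0l !basic_mul0r basic_mul0l.
- by rewrite basic_mulDl !basic_mulDr basic_mulDl IHv IHv'.
elim/tens_ind: w => [e f||w w' IHw IHw']; last 2 first.
- by rewrite !basic_mul0r.
- by rewrite !basic_mulDr IHw IHw'.
by rewrite !basic_mulE mulrA (ss_bimodr SP) rmorphM mulrA.
Qed.

Lemma basic_mul1l : left_id basic_one basic_mul.
Proof.
elim/tens_ind=> [a b||u v IHu IHv].
- rewrite basic_mul_suml (eq_bigr (fun i => (x i * iota (E (y i * a))) ⊗ b)).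
    by rewrite -tens_suml (ss_duall SP).
  by move=> i _; rewrite basic_mulE.
- by rewrite basic_mul0r.
- by rewrite basic_mulDr IHu IHv.
Qed.

Lemma basic_mul1r : right_id basic_one basic_mul.
Proof.
elim/tens_ind=> [a b||u v IHu IHv].
- rewrite basic_mul_sumr (eq_bigr (fun i => a ⊗ (iota (E (b * x i)) * y i))).
    by rewrite -tens_sumr (ss_dualr SP).
  by move=> i _; rewrite basic_mulE tensM.
- by rewrite basic_mul0l.
- by rewrite basic_mulDl IHu IHv.
Qed.

(* E_M (a (x) b) = lam a b                                                    *)
Definition basic_proj (u : basic) : M := tlift iota (fun a b => lam *: (a * b)) u.

Lemma basic_proj_bal : balanced iota (fun a b => lam *: (a * b)).
Proof. by split=> *; rewrite ?(mulrDl, mulrDr, scalerDr, mulrA). Qed.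

Lemma basic_projE a b : basic_proj (a ⊗ b) = lam *: (a * b).
Proof. exact: (tlift_tens basic_proj_bal). Qed.

Lemma basic_proj_is_nmod : nmod_morphism basic_proj.
Proof. by split; [apply: (tlift0 basic_proj_bal)|apply: (tliftD basic_proj_bal)]. Qed.

HB.instance Definition _ :=
  GRing.isNmodMorphism.Build basic M basic_proj basic_proj_is_nmod.

Lemma basic_proj1 : basic_proj basic_one = 1.
Proof.
rewrite raddf_sum (eq_bigr (fun i => lam *: (x i * y i))).
  by rewrite -scaler_sumr (ss_sum SP) scalerA divff ?scale1r ?(ss_index SP).
by move=> i _; apply: basic_projE.
Qed.

Lemma basic_one_neq0 : basic_one != 0.
Proof.
apply/eqP=> e; have := basic_proj1; rewrite e raddf0 => /esym/eqP.
by rewrite oner_eq0.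
Qed.

HB.instance Definition _ :=
  GRing.Zmodule_isNzRing.Build basic
    basic_mulA basic_mul1l basic_mul1r basic_mulDl basic_mulDr basic_one_neq0.

Lemma basicM a b c d : (a ⊗ b) * (c ⊗ d) = (a * iota (E (b * c))) ⊗ d.
Proof. exact: basic_mulE. Qed.

Lemma basicZ c a b : c *: (a ⊗ b) = (c *: a) ⊗ b.
Proof. exact: tensZ. Qed.

Lemma basic_scaleAl (c : k) (u v : basic) : c *: (u * v) = (c *: u) * v.
Proof.
elim/tens_ind: u => [a b||u u' IHu IHu']; last 2 first.
- by rewrite mul0r scaler0 mul0r.
- by rewrite mulrDl !scalerDr mulrDl IHu IHu'.
elim/tens_ind: v => [d e||v v' IHv IHv']; last 2 first.
- by rewrite !mulr0 scaler0.
- by rewrite !mulrDr scalerDr IHv IHv'.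
by rewrite basicZ !basicM basicZ scalerAl.
Qed.

HB.instance Definition _ := GRing.Lmodule_isLalgebra.Build k basic basic_scaleAl.

Lemma basic_scaleAr (c : k) (u v : basic) : c *: (u * v) = u * (c *: v).
Proof.
elim/tens_ind: u => [a b||u u' IHu IHu']; last 2 first.
- by rewrite !mul0r scaler0.
- by rewrite !mulrDl scalerDr IHu IHu'.
elim/tens_ind: v => [d e||v v' IHv IHv']; last 2 first.
- by rewrite mulr0 !scaler0 mulr0.
- by rewrite mulrDr !scalerDr mulrDr IHv IHv'.
by rewrite (basicZ c d) tens_scale !basicM basicZ tens_scale.
Qed.

HB.instance Definition _ := GRing.Lalgebra_isAlgebra.Build k basic basic_scaleAr.

Definition basic_incl (m : M) : basic := \sum_(i < r) (m * x i) ⊗ y i.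

Lemma basic_inclMl m a b : basic_incl m * (a ⊗ b) = (m * a) ⊗ b.
Proof.
rewrite mulr_suml (eq_bigr (fun i => (m * (x i * iota (E (y i * a)))) ⊗ b)).
  by rewrite -tens_suml -mulr_sumr (ss_duall SP).
by move=> i _; rewrite basicM mulrA.
Qed.

Lemma basic_inclMr m a b : (a ⊗ b) * basic_incl m = a ⊗ (b * m).
Proof.
rewrite mulr_sumr (eq_bigr (fun i => a ⊗ (iota (E (b * m * x i)) * y i))).
  by rewrite -tens_sumr (ss_dualr SP).
by move=> i _; rewrite basicM tensM mulrA.
Qed.

Lemma basic_incl_linear : linear basic_incl.
Proof.
move=> c m m'; rewrite scaler_sumr -big_split; apply: eq_bigr => i _ /=.
by rewrite mulrDl tensDl basicZ scalerAl.
Qed.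

HB.instance Definition _ :=
  GRing.isLinear.Build k M basic *:%R basic_incl basic_incl_linear.

Lemma basic_incl_monoid : monoid_morphism basic_incl.
Proof.
split=> [|m m'].
  by apply: eq_bigr => i _; rewrite mul1r.
rewrite [in RHS]/basic_incl mulr_sumr; apply: eq_bigr => i _.
by rewrite basic_inclMl mulrA.
Qed.

HB.instance Definition _ :=
  GRing.isMonoidMorphism.Build M basic basic_incl basic_incl_monoid.

Definition basic_dbx (i : 'I_r) : basic := lam^-1 *: (x i ⊗ 1).
Definition basic_dby (i : 'I_r) : basic := 1 ⊗ y i.

Lemma basic_strongly_separable :
  strongly_separable lam basic_incl basic_proj basic_dbx basic_dby.
Proof.
have l0 := ss_index SP.
split=> //.
- move=> m u; elim/tens_ind: u => [a b||u v IHu IHv]; last 2 first.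
  + by rewrite mulr0 raddf0 mulr0.
  + by rewrite mulrDr !raddfD mulrDr /= IHu IHv.
  by rewrite basic_inclMl /= !basic_projE -mulrA scalerAr.
- move=> u m; elim/tens_ind: u => [a b||u v IHu IHv]; last 2 first.
  + by rewrite mul0r raddf0 mul0r.
  + by rewrite mulrDl !raddfD mulrDl /= IHu IHv.
  by rewrite basic_inclMr /= !basic_projE mulrA scalerAl.
- exact: basic_proj1.
- move=> u; elim/tens_ind: u => [a b||u v IHu IHv].
  + rewrite (eq_bigr (fun i => a ⊗ (iota (E (b * x i)) * y i))).
      by rewrite -tens_sumr (ss_dualr SP).
    move=> i _; rewrite /basic_dbx -scalerAr basicM basicZ /= basic_projE mulr1.
    by rewrite scalerA divff // scale1r basic_inclMl mulr1 tensM.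
  + by rewrite big1 // => i _; rewrite mul0r raddf0 raddf0 mul0r.
  + rewrite -[in RHS]IHu -[in RHS]IHv -big_split; apply: eq_bigr => i _ /=.
    by rewrite mulrDl !raddfD mulrDl.
- move=> u; elim/tens_ind: u => [a b||u v IHu IHv].
  + rewrite (eq_bigr (fun i => (x i * iota (E (y i * a))) ⊗ b)).
      by rewrite -tens_suml (ss_duall SP).
    move=> i _; rewrite /basic_dby basicM mul1r /= basic_projE linearZ /=.
    rewrite -scalerAl -scalerAr scalerA mulVf // scale1r.
    by rewrite basic_inclMr mul1r tensM.
  + by rewrite big1 // => i _; rewrite mulr0 raddf0 raddf0 mulr0.
  + rewrite -[in RHS]IHu -[in RHS]IHv -big_split; apply: eq_bigr => i _ /=.
    by rewrite mulrDr !raddfD mulrDr.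
- rewrite (eq_bigr (fun i => lam^-1 *: (x i ⊗ y i))).
    by rewrite -scaler_sumr.
  move=> i _; rewrite /basic_dbx /basic_dby -scalerAl basicM mulr1.
  by rewrite (ss_unital SP) rmorph1 mulr1.
Qed.

Definition basic_extension : extension lam := Extension basic_strongly_separable.

(* e_1 = 1 (x) 1                                                              *)
Definition jones_idem : ext_top basic_extension := 1 ⊗ 1.

End BasicConstruction.

Section Tower.
Variables (k : fieldType) (lam : k) (S : extension lam).

(* tower i is the extension M_i / M_(i-1), where M_(-1) = N.                  *)
Fixpoint tower (i : nat) : extension lam :=
  if i is j.+1 then basic_extension (tower j) else S.

Definition tower_alg (i : nat) : algType k := ext_top (tower i).
Local Notation M := tower_alg.

Definition tower_incl (i : nat) : {lrmorphism M i -> M i.+1} :=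
  incl (tower i.+1).
Definition tower_proj (i : nat) : {additive M i.+1 -> M i} :=
  proj (tower i.+1).

(* The inclusions N -> M_n and M_n -> M_(d+n).                                *)
Fixpoint incl_base (n : nat) : ext_bot S -> M n :=
  if n is j.+1 then fun a => tower_incl j (incl_base j a) else incl S.

Fixpoint incl_up (n d : nat) : M n -> M (d + n) :=
  if d is d'.+1 then fun a => tower_incl (d' + n) (incl_up d' a) else id.

(* E o E_M o ... o E_(M_(n-1)) : M_n -> N                                     *)
Fixpoint proj_base (n : nat) : M n -> ext_bot S :=
  if n is j.+1 then fun u => proj_base (tower_proj j u) else proj S.

(* E_(M_n) o ... o E_(M_(n+d-1)) : M_(d+n) -> M_n                             *)
Fixpoint proj_down (n d : nat) : M (d + n) -> M n :=
  if d is d'.+1 then fun u => proj_down (tower_proj (d' + n) u) else id.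

(* jones j i is e_i viewed in M_j, for 1 <= i <= j (and 0 otherwise).         *)
Fixpoint jones (j : nat) : nat -> M j :=
  if j is j'.+1 then
    fun i => if i == j'.+1 then jones_idem (tower j')
             else tower_incl j' (jones j' i)
  else fun _ => 0.

(* f_n, in M_(2n+1); 2n+1 is written n.+1 + n so as to be of the form d + n   *)
(* above. The j-th factor is e_(n+1+j) e_(n+j) ... e_(1+j), for 0 <= j <= n.  *)
Definition multi_jones (n : nat) : M (n.+1 + n) :=
  lam ^- ((n * n.+1) %/ 2) *:
    \prod_(j < n.+1) \prod_(i < n.+1) jones (n.+1 + n) (n.+1 + j - i).

End Tower.

Arguments tower_alg {k lam} S i.
Arguments incl_base {k lam} S n a.
Arguments incl_up {k lam S n} d a.
Arguments proj_base {k lam} S n u.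
Arguments proj_down {k lam S n} d u.
Arguments jones {k lam} S j i.
Arguments multi_jones {k lam} S n.

(* Main.v *)
Require Import Defs.
From mathcomp Require Import all_boot all_order all_algebra.
From mathcomp Require Import zify.

Set Implicit Arguments.
Unset Strict Implicit.
Unset Printing Implicit Defensive.

Import GRing.Theory.
Local Open Scope ring_scope.

(** Write f_n = lam^(-n(n+1)/2) d_n, where d_n is the unnormalised word in the
    Jones idempotents. Drawn with the index of each letter as its height, d_n
    is a diamond. Stripping off its upper left and upper right edges leaves
    the smaller diamond:
      d_(n+1) = p e_(2n+3) d_n q,
      p = e_(n+2) ... e_(2n+2),  q = e_(2n+2) ... e_(n+2)
    (lemma [diamondS]). This rests only on e_i e_j = e_j e_i for |i - j| > 1.
    All the claims follow from this recursion by induction on n.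

    Compression. For x in M_(n+1), the identity e_(n+2) x e_(n+2) =
    E_(M_n)(x) e_(n+2) and the braid relations collapse q x p to
    lam^n E_(M_n)(x) e_(2n+2) ([desc_asc_compress]). Surrounded by two copies
    of e_(2n+3), which commute with d_n and M_n, the letter e_(2n+2) turns
    into one more factor lam, and d_n E_(M_n)(x) d_n is left to the induction
    hypothesis ([diamond_compress]). The value x = 1 gives idempotency.

    Expectation. The outermost expectation replaces e_(2n+3) by lam; each of
    the following ones opens up one pair of letters of p and q around the
    image of d_n, at the price of lam ([proj_asc_desc], [proj_diamond]).

    Span. From M_(i+1) = M_i e_(i+1) M_i one gets
    M_(2n+2) = M_(n+1) p M_(2n+1) = M_(2n+1) q M_(n+1), hence
    M_(2n+3) = M_(n+1) p e_(2n+3) M_(2n+1) q M_(n+1). By induction M_(2n+1) is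
    M_n d_n M_n, and M_n commutes with p, q and e_(2n+3) ([diamond_span]).

    These arguments take place in a single algebra with an increasing chain
    of subalgebras; [jones_system] lists what they use, and
    [tower_jones_system] shows that each algebra M_K of the tower, with the
    images of the smaller ones, provides it. *)

(** * Additive spans of products *)

(** Only sums occur, since the sets spanned by below absorb scalars. *)
Inductive addspan (A : zmodType) (P : A -> Prop) : A -> Prop :=
| addspan0 : addspan P 0
| addspan_gen a : P a -> addspan P a
| addspanD a b : addspan P a -> addspan P b -> addspan P (a + b).

Definition sandwich (A : pzRingType) (P : A -> Prop) (c : A) (Q : A -> Prop)
    (z : A) : Prop :=
  exists a b, [/\ P a, Q b & z = a * c * b].

Lemma addspan_bind (A : pzRingType) (P R : A -> Prop) p q z :
  (forall a, P a -> addspan R (p * a * q)) ->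
  addspan P z -> addspan R (p * z * q).
Proof.
move=> PR; elim=> [|a /PR //|a b _ Ra _ Rb].
  by rewrite mulr0 mul0r; apply: addspan0.
by rewrite mulrDr mulrDl; apply: addspanD.
Qed.

Lemma addspan_bind2 (A : pzRingType) (P Q R : A -> Prop) c y z :
  (forall a b, P a -> Q b -> addspan R (a * c * b)) ->
  addspan P y -> addspan Q z -> addspan R (y * c * z).
Proof.
move=> PQR Py Qz; rewrite -[y * c * z]mulr1; apply: addspan_bind Qz => b Qb.
rewrite mulr1 -[y]mul1r -mulrA; apply: addspan_bind Py => a Pa.
by rewrite mul1r mulrA; apply: PQR.
Qed.

(** * Jones towers inside one algebra *)

(** The picture inside one algebra A of a tower N = M_(-1), M_0, ..., M_K = A.
    The level l is the image of M_(l-1), so that N is level 0; G l is the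
    composite expectation of A onto level l, viewed as a map from A to A; and
    e i is the Jones idempotent e_i, meaningful for 1 <= i <= K. Working with
    self-maps and predicates of A avoids transporting elements between the
    algebras of the tower. The other braid relation,
    e_(i+1) e_i e_(i+1) = lam e_(i+1), is [braid_succ] below. *)
Record jones_system (k : fieldType) (lam : k) (A : algType k) (K : nat)
    (L : nat -> A -> Prop) (G : nat -> A -> A) (e : nat -> A) : Prop :=
  JonesSystem {
  js_scal : forall l c, L l c%:A;
  js_mul : forall l a b, L l a -> L l b -> L l (a * b);
  js_sub : forall l m a, (l <= m)%N -> L l a -> L m a;
  js_proj_in : forall l a, L l (G l a);
  js_proj_id : forall l a, L l a -> G l a = a;
  js_proj_bimod : forall l a b c,
    L l a -> L l b -> G l (a * c * b) = a * G l c * b;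
  js_projK : forall l m a, (l <= m)%N -> G l (G m a) = G l a;
  js_idem_in : forall i, (i < K)%N -> L i.+2 (e i.+1);
  js_comm : forall i a, (i < K)%N -> L i a -> e i.+1 * a = a * e i.+1;
  js_compress : forall i a, (i < K)%N -> L i.+1 a ->
    e i.+1 * a * e i.+1 = G i a * e i.+1;
  js_span : forall i z, (i < K)%N -> L i.+2 z ->
    addspan (sandwich (L i.+1) (e i.+1) (L i.+1)) z;
  js_braid : forall i, (i.+1 < K)%N ->
    e i.+1 * e i.+2 * e i.+1 = lam *: e i.+1;
  js_proj_idem : forall i, (i < K)%N -> G i.+1 (e i.+1) = lam%:A }.

Section JonesWords.
Variables (k : fieldType) (lam : k) (A : algType k) (K : nat).
Variables (L : nat -> A -> Prop) (G : nat -> A -> A) (e : nat -> A).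
Hypothesis J : jones_system lam K L G e.

Let sub := js_sub J.
Let mul := js_mul J.

Lemma level1 l : L l 1.
Proof. by rewrite -[1]scale1r; apply: (js_scal J). Qed.

Lemma projZ l c a : G l (c *: a) = c *: G l a.
Proof.
rewrite -[c *: a]mulr_algl -[c%:A * a]mulr1.
rewrite (js_proj_bimod J) ?mulr1 ?mulr_algl //.
  exact: js_scal J _ _.
exact: level1.
Qed.

Lemma level_idem i l : (i < K)%N -> (i.+2 <= l)%N -> L l (e i.+1).
Proof. by move=> iK il; apply: (sub il); apply: js_idem_in J _ _. Qed.

Lemma braid_succ i : (i.+1 < K)%N -> e i.+2 * e i.+1 * e i.+2 = lam *: e i.+2.
Proof.
move=> iK; rewrite (js_compress J) ?(js_proj_idem J) ?mulr_algl //; try lia.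
by apply: level_idem; lia.
Qed.

(** ** Ascending and descending words *)

(** The indices are such that, as m grows, desc n m * a * asc n m gains letters
    at its outer ends and asc n m * z * desc n m at its inner ends; compression
    uses the former and the expectation of a diamond the latter. *)
Definition asc n m : A := \prod_(i < m) e (i + n).+1.
Definition desc n m : A := \prod_(i < m) e (m + n - i).

Lemma ascS n m : asc n m.+1 = asc n m * e (m + n).+1.
Proof. by rewrite /asc big_ord_recr. Qed.

Lemma descS n m : desc n m.+1 = e (m + n).+1 * desc n m.
Proof. by rewrite /desc big_ord_recl /=. Qed.

Lemma asc0 n : asc n 0 = 1. Proof. exact: big_ord0. Qed.
Lemma desc0 n : desc n 0 = 1. Proof. exact: big_ord0. Qed.

Lemma level_asc n m l : (m + n <= K)%N -> (m + n < l)%N -> L l (asc n m).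
Proof.
elim: m => [|m IHm] mK ml; first by rewrite asc0; apply: level1.
by rewrite ascS; apply: mul; [apply: IHm|apply: level_idem]; lia.
Qed.

Lemma level_desc n m l : (m + n <= K)%N -> (m + n < l)%N -> L l (desc n m).
Proof.
elim: m => [|m IHm] mK ml; first by rewrite desc0; apply: level1.
by rewrite descS; apply: mul; [apply: level_idem|apply: IHm]; lia.
Qed.

Lemma idem_comm i l a : (i < K)%N -> (l <= i)%N -> L l a ->
  e i.+1 * a = a * e i.+1.
Proof. by move=> iK li La; apply: (js_comm J) => //; apply: sub La. Qed.

Lemma asc_comm n m a : (m + n <= K)%N -> L n a -> asc n m * a = a * asc n m.
Proof.
move=> mK La; elim: m mK => [|m IHm] mK; first by rewrite asc0 mulr1 mul1r.
by rewrite ascS -mulrA (@idem_comm _ n) ?mulrA ?IHm //; lia.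
Qed.

Lemma desc_comm n m a : (m + n <= K)%N -> L n a -> desc n m * a = a * desc n m.
Proof.
move=> mK La; elim: m mK => [|m IHm] mK; first by rewrite desc0 mulr1 mul1r.
by rewrite descS -mulrA IHm ?mulrA ?(@idem_comm _ n) //; lia.
Qed.

(** The innermost pair e_(n+1) a e_(n+1) is compressed to G n a, which commutes
    with all the letters; the other pairs are then absorbed by braid relations,
    each contributing a factor lam. *)
Lemma desc_asc_compress n m a : (m + n < K)%N -> L n.+1 a ->
  desc n m.+1 * a * asc n m.+1 = lam ^+ m *: (G n a * e (m + n).+1).
Proof.
move=> mK La; elim: m mK => [|m IHm] mK.
  by rewrite descS ascS desc0 asc0 mulr1 mul1r (js_compress J) ?expr0 ?scale1r.
transitivity
  (e (m.+1 + n).+1 * (desc n m.+1 * a * asc n m.+1) * e (m.+1 + n).+1).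
  by rewrite descS ascS !mulrA.
rewrite IHm; last lia.
rewrite -scalerAr -scalerAl mulrA.
rewrite (@idem_comm _ n); [|lia|lia|exact: js_proj_in J _ _].
rewrite -!mulrA [e (m.+1 + n).+1 * _]mulrA addSn braid_succ; last lia.
by rewrite -scalerAr scalerA -exprSr.
Qed.

(** ** The diamond words *)

(** The word of f_n without its normalisation. *)
Definition diamond n : A := \prod_(j < n.+1) desc j n.+1.

Lemma prodr_split_comm (a b : nat -> A) m :
  (forall i j, (i < j < m)%N -> GRing.comm (b i) (a j)) ->
  \prod_(j < m) (a j * b j) = \prod_(j < m) a j * \prod_(j < m) b j.
Proof.
elim: m => [|m IHm] ab; first by rewrite !big_ord0 mulr1.
rewrite !big_ord_recr /= IHm => [|i j ij]; last by apply: ab; lia.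
rewrite -!mulrA; congr (_ * _); rewrite !mulrA; congr (_ * _).
apply/commr_sym/commr_prod => i _; apply/commr_sym/ab.
by rewrite ltn_ord leqnn.
Qed.

(** Each factor of d_(n+1) is its first letter times a factor of
    d_n * (e_(2n+2) ... e_(n+2)), and these first letters can all be moved to
    the front, since they are at distance at least 2 from the letters that
    they pass. *)
Lemma diamondS n : (n.+1 + n.+1 < K)%N ->
  diamond n.+1 =
  asc n.+1 n.+1 * e (n.+1 + n.+1).+1 * diamond n * desc n.+1 n.+1.
Proof.
move=> nK; rewrite -ascS -mulrA.
have -> : diamond n * desc n.+1 n.+1 = \prod_(j < n.+2) desc j n.+1.
  by rewrite big_ord_recr.
rewrite /asc -(@prodr_split_comm (fun j => e (j + n.+1).+1) (desc^~ n.+1)).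
  by apply: eq_bigr => j _; rewrite descS addnC.
move=> i j ij; apply/esym/(@idem_comm _ (j + n.+1)); try lia.
by apply: level_desc; lia.
Qed.

Lemma diamond0 : diamond 0 = e 1.
Proof. by rewrite /diamond big_ord1 descS desc0 mulr1. Qed.

Lemma level_diamond n l : (n + n < K)%N -> (n + n < l.-1)%N -> L l (diamond n).
Proof.
move=> nK nl; rewrite /diamond.
apply: (big_ind (L l)) => [||j _]; [exact: level1|exact: mul|].
by apply: level_desc; have := ltn_ord j; lia.
Qed.

Lemma diamond_comm n a : (n + n < K)%N -> L 0 a ->
  diamond n * a = a * diamond n.
Proof.
move=> nK La; apply/esym/commr_prod => j _; apply/esym/desc_comm.
  by have := ltn_ord j; lia.
exact: sub La.
Qed.

(** The n+1 factors lam gained when passing from n to n+1 are those of the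
    normalisation lam^(n(n+1)/2). *)
Lemma triangleS n : ((n.+1 * n.+2) %/ 2 = n.+1 + (n * n.+1) %/ 2)%N.
Proof. by lia. Qed.

(** Main step for both idempotency and the compression property: the two
    adjacent edges q and p collapse to one letter e_(2n+2), which is itself
    absorbed between the two letters e_(2n+3). *)
Lemma diamond_compress n a : (n + n < K)%N -> L n.+1 a ->
  diamond n * a * diamond n =
  lam ^+ ((n * n.+1) %/ 2) *: (diamond n * G 0 a).
Proof.
elim: n a => [|n IHn] a nK La.
  rewrite diamond0 (js_compress J) // mul0n expr0 scale1r.
  by rewrite (js_comm J) //; apply: js_proj_in J _ _.
have L0 := js_proj_in J 0 a.
have Ly : L n.+1 (G n.+1 a) by apply: js_proj_in J _ _.
have mK : (n.+1 + n.+1 < K)%N by lia.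
rewrite {1 2}diamondS //.
set p := asc _ _; set q := desc _ _; set d := diamond n; set e' := e _.
have de : e' * d = d * e'.
  by apply: (js_comm J) => //; apply: level_diamond; lia.
have ye : e' * G n.+1 a = G n.+1 a * e'.
  by apply: (@idem_comm _ n.+1) => //; lia.
have eee : e' * e (n + n.+1).+1 * e' = lam *: e'.
  by rewrite /e' addSn braid_succ //; lia.
have qap : q * a * p = lam ^+ n *: (G n.+1 a * e (n + n.+1).+1).
  by apply: desc_asc_compress => //; lia.
have dyd : d * G n.+1 a * d = lam ^+ (n * n.+1 %/ 2) *: (d * G 0 a).
  by rewrite IHn ?(js_projK J) //; lia.
have zq : q * G 0 a = G 0 a * q.
  by apply: desc_comm; [lia|apply: sub L0].
have ze : e' * G 0 a = G 0 a * e' by apply: (@idem_comm _ 0).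
(* The descending edge of the first copy meets the ascending edge of the
   second one. *)
transitivity (p * d * e' * (q * a * p) * e' * d * q).
  by rewrite -(mulrA p d e') -de !mulrA.
rewrite qap -scalerAr -!scalerAl.
transitivity
  (lam ^+ n *: (p * d * G n.+1 a * (e' * e (n + n.+1).+1 * e') * d * q)).
  by rewrite -(mulrA (p * d) e') (mulrA e') ye !mulrA.
rewrite eee -scalerAr -!scalerAl scalerA -exprSr.
rewrite -(mulrA _ e' d) de.
transitivity (lam ^+ n.+1 *: (p * (d * G n.+1 a * d) * e' * q)).
  by rewrite !mulrA.
rewrite dyd -scalerAr -!scalerAl scalerA -exprD -triangleS.
rewrite diamondS // -/p -/q -/d -/e'.
congr (_ *: _).
(* G 0 a travels to the right end through e' and q. *)
rewrite -(mulrA p e' d) de -(mulrA _ q) zq !mulrA; congr (_ * _).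
by rewrite -(mulrA _ e') ze !mulrA.
Qed.

(** The pair of letters around z gives e z e = G(z) e with G(z) one level
    lower; applying the expectation to e then leaves lam and a shorter word of
    the same form. *)
Lemma proj_asc_desc n m z : (m + n <= K)%N -> L (m + n) z ->
  G n.+1 (asc n m * z * desc n m) = lam ^+ m *: G n z.
Proof.
elim: m z => [|m IHm] z mK Lz.
  have Lz' : L n.+1 z by apply: sub Lz; lia.
  by rewrite asc0 desc0 mul1r mulr1 expr0 scale1r !(js_proj_id J).
rewrite ascS descS -(js_projK J (l := n.+1) (m := (m + n).+1)); last lia.
set z' := G (m + n) z.
have Lz' : L (m + n) z' by apply: js_proj_in J _ _.
(* Only one of the two letters e_(m+n+1) survives, and it is isolated. *)
transitivity (G n.+1 (G (m + n).+1 (asc n m * e (m + n).+1 * (z' * desc n m)))).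
  congr (G _ (G _ _)); rewrite -!mulrA; congr (_ * _); rewrite !mulrA.
  by rewrite (js_compress J) // (js_comm J).
rewrite (js_proj_bimod J); last 2 first.
- by apply: level_asc; lia.
- by apply: mul; [apply: sub Lz'; lia|apply: level_desc; lia].
rewrite (js_proj_idem J) // mulr_algr -scalerAl mulrA projZ IHm //; last lia.
by rewrite scalerA -exprS (js_projK J) //; lia.
Qed.

Lemma proj_diamond n : (n + n < K)%N ->
  G n.+1 (diamond n) = (lam ^+ ((n * n.+1) %/ 2 + n.+1))%:A.
Proof.
elim: n => [|n IHn] nK; first by rewrite diamond0 (js_proj_idem J).
have mK : (n.+1 + n.+1 < K)%N by lia.
rewrite diamondS // -(js_projK J (l := n.+2) (m := (n.+1 + n.+1).+1)); last lia.
rewrite -(mulrA _ (diamond n)) (js_proj_bimod J); last 2 first.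
- by apply: level_asc; lia.
- by apply: mul; [apply: level_diamond; lia|apply: level_desc; lia].
rewrite (js_proj_idem J) // mulr_algr -scalerAl mulrA projZ.
rewrite proj_asc_desc; last 2 first.
- lia.
- by apply: level_diamond; lia.
rewrite IHn; last lia.
rewrite !scalerA -exprS -exprD; congr (_ ^+ _ *: _).
by rewrite triangleS; lia.
Qed.

(** ** Factorisations of the levels *)

(** In M_(m+n) e_(m+n+1) M_(m+n), the left factor is expanded by induction; its
    last piece lies in M_(m+n-1), so it moves past e_(m+n+1) to the right. *)
Lemma level_asc_span n m z : (m + n <= K)%N -> L (m + n).+1 z ->
  addspan (sandwich (L n.+1) (asc n m) (L (m + n))) z.
Proof.
elim: m z => [|m IHm] z mK Lz.
  apply: addspan_gen; exists z, 1; split=> //; first exact: level1.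
  by rewrite asc0 !mulr1.
rewrite -[z]mul1r -[1 * z]mulr1.
apply: addspan_bind (js_span J mK Lz) => _ [a [b [La Lb ->]]].
rewrite mul1r mulr1.
apply: addspan_bind2 (IHm a (ltnW mK) La) (addspan_gen Lb) => {a La b Lb}.
move=> _ b [c [d [Lc Ld ->]]] Lb; apply: addspan_gen; exists c, (d * b).
split=> //; first by apply: mul => //; apply: sub Ld.
by rewrite ascS !mulrA -(mulrA _ d) -(js_comm J) // !mulrA.
Qed.

Lemma level_desc_span n m z : (m + n <= K)%N -> L (m + n).+1 z ->
  addspan (sandwich (L (m + n)) (desc n m) (L n.+1)) z.
Proof.
elim: m z => [|m IHm] z mK Lz.
  apply: addspan_gen; exists 1, z; split=> //; first exact: level1.
  by rewrite desc0 !mul1r.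
rewrite -[z]mul1r -[1 * z]mulr1.
apply: addspan_bind (js_span J mK Lz) => _ [a [b [La Lb ->]]].
rewrite mul1r mulr1.
apply: addspan_bind2 (addspan_gen La) (IHm b (ltnW mK) Lb) => {a La b Lb}.
move=> a _ La [c [d [Lc Ld ->]]]; apply: addspan_gen; exists (a * c), d.
split=> //; first by apply: mul => //; apply: sub Lc.
by rewrite descS !mulrA -(mulrA _ _ c) (js_comm J) // !mulrA.
Qed.

(** The two expansions of M_(2n+2) around e_(2n+3) leave M_(2n+1) in the middle;
    when M_(2n+1) is expanded in turn, its outer factors in M_n slide out
    through p, e_(2n+3) and q. *)
Lemma diamond_span n z : (n + n < K)%N -> L (n + n).+2 z ->
  addspan (sandwich (L n.+1) (diamond n) (L n.+1)) z.
Proof.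
elim: n z => [|n IHn] z nK Lz.
  by rewrite diamond0; apply: js_span J _ _ _ _.
have mK : (n.+1 + n.+1 < K)%N by lia.
rewrite -[z]mul1r -[1 * z]mulr1.
apply: addspan_bind (js_span J mK Lz) => _ [a [b [La Lb ->]]].
rewrite mul1r mulr1.
apply: addspan_bind2 (level_asc_span (ltnW mK) La)
                     (level_desc_span (ltnW mK) Lb).
move=> {z Lz a La b Lb} _ _ [a [c [La Lc ->]]] [d [b [Ld Lb ->]]].
set p := asc _ _; set q := desc _ _; set e' := e _.
(* The middle parts of the two expansions join in M_(2n+1), to which the
   induction hypothesis applies. *)
have -> : a * p * c * e' * (d * q * b) = a * p * e' * (c * d) * (q * b).
  by rewrite !mulrA -(mulrA _ c) -(js_comm J) // !mulrA.
have Lcd : L (n + n).+2 (c * d) by have := mul Lc Ld; rewrite addnS.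
apply: addspan_bind (IHn _ _ Lcd) => [_ [u [v [Lu Lv ->]]]|]; last lia.
apply: addspan_gen; exists (a * u), (v * b).
split; try by apply: mul => //; first [apply: sub Lu | apply: sub Lv].
have ue : e' * u = u * e' by apply: (@idem_comm _ n.+1) => //; lia.
have pu : p * u = u * p by apply: asc_comm => //; lia.
have qv : q * v = v * q by apply: desc_comm => //; lia.
rewrite diamondS // -/p -/q -/e' !mulrA -(mulrA _ e' u) ue mulrA.
by rewrite -(mulrA a p u) pu -(mulrA _ q v) qv !mulrA.
Qed.

End JonesWords.

(** * The tower as a Jones system *)

Lemma incl_projK (k : fieldType) (lam : k) (T : extension lam) :
  cancel (incl T) (proj T).
Proof.
move=> n; have P := extensionP T.
by rewrite -[incl T n]mulr1 (ss_bimodl P) (ss_unital P) mulr1.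
Qed.

Section BasicIdempotent.
Variables (k : fieldType) (lam : k) (T : extension lam).
Local Notation e1 := (jones_idem T).
Local Notation in1 := (incl (basic_extension T)).
Let P := extensionP T.

(** The idempotent is 1 (x) 1 over the bottom algebra, so elements of the
    bottom algebra can cross the tensor sign. *)
Lemma jones_idem_comm b : e1 * in1 (incl T b) = in1 (incl T b) * e1.
Proof.
rewrite [LHS]basic_inclMr [RHS]basic_inclMl mul1r mulr1.
by rewrite -[in RHS](mul1r (incl T b)) tensM mulr1.
Qed.

Lemma jones_idem_compress a : e1 * in1 a * e1 = in1 (incl T (proj T a)) * e1.
Proof.
rewrite [e1 * in1 a]basic_inclMr mul1r [LHS]basicM [RHS]basic_inclMl.
by rewrite mul1r !mulr1.
Qed.

Lemma tens_jones_idem a b : tens (incl T) a b = in1 a * e1 * in1 b.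
Proof. by rewrite [in1 a * e1]basic_inclMl [RHS]basic_inclMr mulr1 mul1r. Qed.

Lemma proj_jones_idem : proj (basic_extension T) e1 = lam%:A.
Proof. by rewrite [LHS]basic_projE mulr1. Qed.

(** This relation involves two successive basic constructions, the second one
    over the first: it compares e_1 (x) e_1 with the dual-basis expansion of
    the image of e_1, and holds because e_1 x_i e_1 = E(x_i) e_1 and
    sum_i E(x_i) y_i = 1. *)
Lemma jones_idem_braid :
  let in2 := incl (basic_extension (basic_extension T)) in
  in2 e1 * jones_idem (basic_extension T) * in2 e1 = lam *: in2 e1.
Proof.
move=> in2; rewrite [in2 e1 * _]basic_inclMl [LHS]basic_inclMr mulr1 mul1r.
pose c i : basic T := in1 (incl T (proj T (dbx i))).
have -> : in2 e1 =
    \sum_i tens in1 (e1 * basic_dbx i) (basic_dby i) by [].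
(* lam (e_1 times the i-th left dual basis element) is e_1 E(x_i), and E(x_i)
   crosses the tensor sign. *)
rewrite scaler_sumr (eq_bigr (fun i => tens in1 e1 (c i * basic_dby i))).
  rewrite -tens_sumr; congr tens.
  rewrite (eq_bigr (fun i => tens (incl T) 1 (incl T (proj T (dbx i)) * dby i))).
    rewrite -tens_sumr; congr tens.
    rewrite -[LHS](ss_dualr P).
    by apply: eq_bigr => i _; rewrite mul1r.
  move=> i _; rewrite [LHS]basic_inclMl mulr1.
  by rewrite -[X in tens _ X]mul1r tensM.
move=> i _; rewrite basicZ -tensM; congr tens.
rewrite [RHS]basic_inclMr mul1r /basic_dbx -scalerAr [_ * _]basicM.
rewrite scalerA divff ?(ss_index P) // scale1r !mul1r.
by rewrite -[X in tens _ X]mul1r tensM mulr1.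
Qed.

End BasicIdempotent.

Section TowerSystem.
Variables (k : fieldType) (lam : k) (S : extension lam).
Local Notation M := (tower_alg S).
Local Notation inc := (tower_incl S).
Local Notation E := (tower_proj S).

(** The image of M_(l-1) in M_K, where M_(-1) = N; levels above K are all of
    M_K. *)
Fixpoint level K : nat -> M K -> Prop :=
  if K is K'.+1 then fun l a =>
    if (l <= K'.+1)%N then exists2 b, level (K := K') l b & a = inc K' b
    else True
  else fun l a => if l is 0 then exists b, a = incl S b else True.

(** The composite expectation of M_K onto the level l, followed by the
    inclusion back into M_K. *)
Fixpoint expect K : nat -> M K -> M K :=
  if K is K'.+1 then fun l a =>
    if (l <= K'.+1)%N then inc K' (expect (K := K') l (E K' a)) else a
  else fun l a => if l is 0 then incl S (proj S a) else a.

Lemma level_top K l (a : M K) : (K < l)%N -> level l a.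
Proof. by case: K a => [|K] a; case: l => // l Kl /=; rewrite leqNgt Kl. Qed.

Lemma expect_top K l (a : M K) : (K < l)%N -> expect l a = a.
Proof. by case: K a => [|K] a; case: l => // l Kl /=; rewrite leqNgt Kl. Qed.

Lemma level_incl K l (b : M K) : level l b -> level l (inc K b).
Proof. by move=> Lb /=; case: ifP => // _; exists b. Qed.

Lemma levelP K l (a : M K.+1) : (l <= K.+1)%N -> level l a ->
  exists2 b, level l b & a = inc K b.
Proof. by move=> lK /=; rewrite lK. Qed.

Lemma expectE K l (a : M K.+1) : (l <= K.+1)%N ->
  expect l a = inc K (expect l (E K a)).
Proof. by move=> lK /=; rewrite lK. Qed.

Lemma tower_inclK K : cancel (inc K) (E K).
Proof. exact: (incl_projK (T := tower S K.+1)). Qed.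

Lemma expect_incl K l (b : M K) : expect l (inc K b) = inc K (expect l b).
Proof.
have [lK|Kl] := leqP l K.+1; first by rewrite expectE // tower_inclK.
by rewrite !expect_top //; lia.
Qed.

Lemma level_bot K (a : M K) : level K a -> exists b, a = incl (tower S K) b.
Proof.
case: K a => [|K] a //= /levelP [] // b _ ->.
by exists b.
Qed.

Lemma expect_bot K (a : M K) :
  expect K a = incl (tower S K) (proj (tower S K) a).
Proof. by case: K a => [|K] a //=; rewrite leqnn expect_top. Qed.

Lemma tower_projBimod K a b c : E K (inc K a * c * inc K b) = a * E K c * b.
Proof.
have P := extensionP (tower S K.+1).
by rewrite (ss_bimodr P) (ss_bimodl P).
Qed.

Lemma jones_top K : jones S K.+1 K.+1 = jones_idem (tower S K).
Proof. by rewrite /= eqxx. Qed.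

Lemma jones_incl K i : (i <= K)%N -> jones S K.+1 i = inc K (jones S K i).
Proof. by move=> iK /=; case: eqP => // ?; lia. Qed.

(** Under M_K -> M_(K+1), levels, expectations and idempotents go to those with
    the same index, so every relation is inherited; the new ones involve
    e_(K+1) and come from the basic construction of the last extension. *)
Lemma tower_jones_system K :
  jones_system lam K (@level K) (@expect K) (jones S K).
Proof.
elim: K => [|K J].
  have P := extensionP S.
  split=> //.
  - by case=> [|l] c //=; exists c%:A; rewrite rmorph_alg.
  - case=> [|l] //= _ _ [a ->] [b ->].
    by exists (a * b); rewrite rmorphM.
  - by case=> [|l] [|m].
  - by case=> [|l] a //=; exists (proj S a).
  - by case=> [|l] //= _ [a ->]; rewrite incl_projK.
  - case=> [|l] //= _ _ c [a ->] [b ->].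
    by rewrite (ss_bimodr P) (ss_bimodl P) !rmorphM.
  - by case=> [|l] [|m] //= a _; rewrite incl_projK.
split.
- move=> l c; have [lK|Kl] := leqP l K.+1; last exact: level_top.
  by rewrite -(rmorph_alg (inc K)); apply/level_incl/(js_scal J).
- move=> l a b; have [lK|Kl] := leqP l K.+1; last by move=> _ _; apply: level_top.
  move=> /(levelP lK) [a' La ->] /(levelP lK) [b' Lb ->].
  by rewrite -rmorphM; apply/level_incl/(js_mul J).
- move=> l m a lm; have [lK|Kl] := leqP l K.+1; last first.
    by move=> _; apply: level_top; lia.
  by move=> /(levelP lK) [b Lb ->]; apply/level_incl/(js_sub J lm Lb).
- move=> l a; have [lK|Kl] := leqP l K.+1; last exact: level_top.
  by rewrite expectE //; apply/level_incl/(js_proj_in J).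
- move=> l a; have [lK|Kl] := leqP l K.+1; last by move=> _; apply: expect_top.
  by move=> /(levelP lK) [b Lb ->]; rewrite expect_incl (js_proj_id J).
- move=> l a b c; have [lK|Kl] := leqP l K.+1; last by rewrite !expect_top.
  move=> /(levelP lK) [a' La ->] /(levelP lK) [b' Lb ->].
  by rewrite !expectE // tower_projBimod (js_proj_bimod J) // !rmorphM.
- move=> l m a lm; have [mK|Km] := leqP m K.+1; last first.
    by rewrite [expect m a]expect_top.
  have lK : (l <= K.+1)%N by lia.
  by rewrite (expectE a mK) expect_incl (expectE a lK) (js_projK J).
- move=> i; rewrite ltnS leq_eqVlt => /orP[/eqP->|iK]; first exact: level_top.
  by rewrite jones_incl //; apply/level_incl/(js_idem_in J).
- move=> i a; rewrite ltnS leq_eqVlt => /orP[/eqP->|iK].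
    move=> /(levelP (leqnSn K)) [b /level_bot [c ->] ->].
    by rewrite jones_top; apply: jones_idem_comm.
  move=> /levelP [|b Lb ->]; first lia.
  by rewrite jones_incl // -!rmorphM (js_comm J).
- move=> i a; rewrite ltnS leq_eqVlt => /orP[/eqP->|iK].
    move=> /(levelP (leqnn _)) [b _ ->].
    rewrite jones_top expect_incl expect_bot.
    exact: jones_idem_compress.
  move=> /levelP [|b Lb ->]; first lia.
  by rewrite jones_incl // expect_incl -!rmorphM (js_compress J).
- move=> i z; rewrite ltnS leq_eqVlt => /orP[/eqP->|iK].
    move=> _; elim/tens_ind: z => [a b||u v Hu Hv].
    + apply: addspan_gen; exists (inc K a), (inc K b); rewrite jones_top.
      split; try by apply/level_incl/level_top.
      exact: tens_jones_idem.
    + exact: addspan0.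
    + exact: addspanD.
  case/levelP=> // b Lb ->; rewrite jones_incl //.
  elim: (js_span J iK Lb) => [|_ [u [v [Lu Lv ->]]]|u v _ Hu _ Hv].
  + by rewrite rmorph0; apply: addspan0.
  + apply: addspan_gen; exists (inc K u), (inc K v).
    by split; rewrite ?rmorphM //; apply: level_incl.
  + by rewrite rmorphD; apply: addspanD.
- move=> i; rewrite ltnS leq_eqVlt => /orP[/eqP Ki|iK].
    case: K / Ki J => J.
    rewrite jones_incl // !jones_top; exact: jones_idem_braid.
  rewrite !jones_incl; try lia.
  rewrite -!rmorphM (js_braid J) //; exact: linearZ.
- move=> i; rewrite ltnS leq_eqVlt => /orP[/eqP->|iK].
    rewrite jones_top expectE // expect_top //.
    rewrite [E K _]proj_jones_idem; exact: rmorph_alg.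
  by rewrite jones_incl // expect_incl (js_proj_idem J) // rmorph_alg.
Qed.

Lemma level_incl_up n d (a : M n) : level n.+1 (incl_up d a).
Proof.
elim: d => [|d IHd]; first exact: level_top.
exact: level_incl.
Qed.

Lemma level_incl_upP n d (u : M (d + n)) : level n.+1 u ->
  exists a, u = incl_up d a.
Proof.
elim: d u => [|d IHd] u; first by exists u.
have ndn : (n < (d + n).+1)%N by rewrite ltnS leq_addl.
by move=> /(levelP ndn) [v /IHd [a ->] ->]; exists a.
Qed.

Lemma expect_incl_up n d (u : M (d + n)) :
  expect n.+1 u = incl_up d (proj_down d u).
Proof.
elim: d u => [|d IHd] u; first exact: expect_top.
have ndn : (n < (d + n).+1)%N by rewrite ltnS leq_addl.
by rewrite (expectE u ndn) IHd.
Qed.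

Lemma incl_up_inj n d : injective (@incl_up k lam S n d).
Proof. by elim: d => [|d IHd] a b //= /(can_inj (@tower_inclK _)) /IHd. Qed.

Lemma incl_up_scal n d c : @incl_up k lam S n d c%:A = c%:A.
Proof. by elim: d => [|d IHd] //=; rewrite IHd rmorph_alg. Qed.

Lemma level_incl_base n a : level 0 (incl_base S n a).
Proof. by elim: n => [|n IHn]; [exists a|apply: level_incl]. Qed.

Lemma expect_incl_base n (u : M n) :
  expect 0 u = incl_base S n (proj_base S n u).
Proof. by elim: n u => [|n IHn] u //; rewrite expectE // IHn. Qed.

Lemma expect0_incl_up n d (a : M n) :
  expect 0 (incl_up d a) = incl_base S (d + n) (proj_base S n a).
Proof.
elim: d => [|d IHd]; first exact: expect_incl_base.
by rewrite [LHS]expect_incl IHd.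
Qed.

End TowerSystem.

(** * The multi-step basic construction *)

Lemma addspan_sum (k : fieldType) (V : lmodType k) (T : Type) (P : V -> Prop)
    (h : T -> T -> V) z :
  (forall v, P v -> exists c a b, v = c *: h a b) -> addspan P z ->
  exists s (c : 'I_s -> k) (a b : 'I_s -> T),
    z = \sum_(i < s) c i *: h (a i) (b i).
Proof.
move=> Ph; elim=> [|v /Ph [c [a [b ->]]]|].
- have T0 (X : Type) : 'I_0 -> X by case.
  by exists 0, (T0 _), (T0 _), (T0 _); rewrite big_ord0.
- by exists 1, (fun=> c), (fun=> a), (fun=> b); rewrite big_ord1.
- move=> u v _ [s [c [a [b ->]]]] _ [t [d [a' [b' ->]]]].
  pose glue X (f : 'I_s -> X) (g : 'I_t -> X) i :=
    match split i with inl j => f j | inr j => g j end.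
  exists (s + t)%N, (glue _ c d), (glue _ a a'), (glue _ b b').
  rewrite big_split_ord /glue; congr (_ + _); apply: eq_bigr => i _.
    by rewrite (unsplitK (inl i)).
  by rewrite (unsplitK (inr i)).
Qed.

Theorem proposition5p1 (k : fieldType) (lam : k) (N M : algType k)
    (iota : {lrmorphism N -> M}) (E : {additive M -> N})
    (r : nat) (x y : 'I_r -> M)
    (MN : strongly_separable lam iota E x y) (n : nat) :
  let S : extension lam := Extension MN in
  let Mn := tower_alg S n in
  let M2n1 := tower_alg S (n.+1 + n) in
  let f : M2n1 := multi_jones S n in
  let F : Mn -> N := proj_base S n in
  let FM : M2n1 -> Mn := proj_down n.+1 in
  let inN : N -> M2n1 := incl_base S (n.+1 + n) in
  let inM : Mn -> M2n1 := incl_up n.+1 in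
  [/\ f * f = f,
      forall z : M2n1, exists (s : nat) (c : 'I_s -> k) (a b : 'I_s -> Mn),
        z = \sum_(i < s) c i *: (inM (a i) * f * inM (b i)),
      forall a : Mn,
        f * inM a * f = f * inN (F a) /\ f * inN (F a) = inN (F a) * f &
      FM f = (lam ^+ n.+1)%:A].
Proof.
move=> S Mn M2n1 f F FM inN inM.
have J := tower_jones_system S (n.+1 + n).
have nK : (n + n < n.+1 + n)%N by lia.
set t := ((n * n.+1) %/ 2)%N.
set d : M2n1 := diamond (jones S (n.+1 + n)) n.
have lt0 : lam ^+ t != 0 by rewrite expf_neq0 // (ss_index MN).
have fE : f = lam ^- t *: d by [].
have dE : d = lam ^+ t *: f by rewrite fE scalerA divff // scale1r.
have ff a : level n.+1 a -> f * a * f = f * expect 0 a.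
  move=> La; rewrite fE -scalerAr -!scalerAl.
  by rewrite (diamond_compress J nK La) [X in _ *: X]scalerA mulVf // scale1r.
split.
- have L1 l : level l (1 : M2n1) by apply: level1 J _.
  by rewrite -{1}[f]mulr1 ff // (js_proj_id J) ?mulr1.
- move=> z; have Lz : level (n + n).+2 z by apply: level_top; lia.
  pose h a b := inM a * f * inM b.
  apply: (@addspan_sum _ _ _ _ h _ _ (diamond_span J nK Lz)).
  move=> _ [_ [_ [/level_incl_upP [a ->] /level_incl_upP [b ->] ->]]].
  exists (lam ^+ t), a, b.
  by rewrite /h -/d dE -scalerAr -scalerAl.
- move=> a; split.
    by rewrite ff ?expect0_incl_up //; apply: level_incl_up.
  by rewrite fE -scalerAl -scalerAr (diamond_comm J nK) //; apply: level_incl_base.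
- apply: (@incl_up_inj _ _ S n n.+1).
  rewrite incl_up_scal -expect_incl_up fE (projZ J) (proj_diamond J nK).
  by rewrite scalerA exprD mulKf.
Qed.
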